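(* Let $N\ge 1$ and consider $N$ coupled two-level systems (qubits) with Hilbert space $(\mathbb{C}^2)^{\otimes N}$ and Ising-like Hamiltonian $$H_S=\frac{1}{2}\,\mathbf{I}+\sum_{j=1}^{N}\frac{\epsilon_j}{2}\,\sigma_z^{j}+\sum_{1\le j<k\le N}\Delta_{zz}^{jk}\,\sigma_z^{j}\sigma_z^{k},$$ where $\epsilon_j,\Delta_{zz}^{jk}\in\mathbb{R}$ (set $\Delta_{zz}^{kj}:=\Delta_{zz}^{jk}$). Let $\rho_M$ be a post-measurement state (any density matrix on $(\mathbb{C}^2)^{\otimes N}$, obtained from a projective or POVM measurement). For $\boldsymbol\theta=(\theta_1,\dots,\theta_N)\in\mathbb{R}^N$ apply the local feedback unitary $U(\boldsymbol\theta)=\bigotimes_{j=1}^N U_j(\theta_j)$, $U_j(\theta_j)=\exp(-i\theta_j\sigma_y^{j}/2)$, giving $\rho_F=U(\boldsymbol\theta)\rho_M U(\boldsymbol\theta)^\dagger$ and post-feedback energy $E_F(\boldsymbol\theta)=\mathrm{Tr}(\rho_F H_S)$. For each $j$ and each $k\neq j$, let $\widetilde{\sigma_z^{k}}(\theta_k):=\sigma_z^{k}\cos\theta_k-\sigma_x^{k}\sin\theta_k$ (the rotated operator $U_k^\dagger(\theta_k)\sigma_z^kU_k(\theta_k)$), and define, as functions of the other angles $\{\theta_k\}_{k\ne j}$, $$A_j=\frac{\epsilon_j}{2}\,\mathrm{Tr}\big(\rho_M\sigma_z^{j}\big)+\sum_{k\neq j}\Delta_{zz}^{jk}\,\mathrm{Tr}\big(\rho_M\,\sigma_z^{j}\,\widetilde{\sigma_z^{k}}(\theta_k)\big),$$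 $$B_j=\frac{\epsilon_j}{2}\,\mathrm{Tr}\big(\rho_M\sigma_x^{j}\big)+\sum_{k\neq j}\Delta_{zz}^{jk}\,\mathrm{Tr}\big(\rho_M\,\sigma_x^{j}\,\widetilde{\sigma_z^{k}}(\theta_k)\big).$$ Then the optimal local feedback angles $\{\theta_j^\ast\}_{j=1}^N$ (minimizers of $E_F$, which are in particular stationary points $\partial E_F/\partial\theta_j=0$ for all $j$) satisfy the set of self-consistent equations $$\tan\theta_j^\ast=\frac{-B_j(\theta_1^\ast,\dots,\theta_{j-1}^\ast,\theta_{j+1}^\ast,\dots,\theta_N^\ast)}{A_j(\theta_1^\ast,\dots,\theta_{j-1}^\ast,\theta_{j+1}^\ast,\dots,\theta_N^\ast)},\qquad\text{i.e.}\qquad \theta_j^\ast\equiv\operatorname{atan2}(-B_j,A_j)\pmod{\pi},$$ for all $1\le j\le N$.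
   Context: $\sigma_x^{j},\sigma_y^{j},\sigma_z^{j}$ denote the Pauli matrices acting on the $j$-th tensor factor (identity on the others); $\mathbf{I}$ is the identity on $(\mathbb{C}^2)^{\otimes N}$. Under $U_j(\theta_j)=\exp(-i\theta_j\sigma_y^j/2)$ one has $U_j^\dagger\sigma_z^jU_j=\sigma_z^j\cos\theta_j-\sigma_x^j\sin\theta_j$ and $U_j^\dagger\sigma_x^jU_j=\sigma_x^j\cos\theta_j+\sigma_z^j\sin\theta_j$. $\operatorname{atan2}(y,x)$ is the two-argument arctangent.
   Formalization: The claim modulo π is stated only when A_j and B_j are not both zero (for ρ_M = I/2, N = 1, both vanish and every angle is optimal); the tangent equation is stated as A_j sin θ_j + B_j cos θ_j = 0, and U_j in the closed form cos(θ_j/2) I − i sin(θ_j/2) σ_y. *)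

(* Defs.v *)
From HB Require Import structures.
From mathcomp Require Import all_boot all_order all_algebra.
From mathcomp Require Import all_classical all_reals all_analysis.
From mathcomp.real_closed Require Import complex.
Set Implicit Arguments. Unset Strict Implicit. Unset Printing Implicit Defensive.
Import Order.TTheory GRing.Theory Num.Theory.
Local Open Scope ring_scope.
Local Open Scope complex_scope.

Section Defs.
Variable R : realType.
Local Notation C := R[i].

(* bit j of the basis index i: the basis vector |i> of (C^2)^{(x)N}
   is |b_0(i)> (x) ... (x) |b_{N-1}(i)> with b_j(i) the j-th binary digit *)
Definition qbit (j : nat) (i : nat) : 'I_2 := @inord 1 (odd (i %/ 2 ^ j)).

Definition kronN (N : nat) (M : 'I_N -> 'M[C]_2) : 'M[C]_(2 ^ N) :=
  \matrix_(i, i') \prod_(j < N) M j (qbit j i) (qbit j i').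

Definition sx : 'M[C]_2 := \matrix_(a, b) (if a == b then 0 else 1).
Definition sy : 'M[C]_2 :=
  \matrix_(a, b) (if a == b then 0 else if a == 0 :> 'I_2 then - 'i else 'i).
Definition sz : 'M[C]_2 :=
  \matrix_(a, b) (if a == b then (if a == 0 :> 'I_2 then 1 else -1) else 0).

Definition onsite (N : nat) (j : 'I_N) (s : 'M[C]_2) : 'M[C]_(2 ^ N) :=
  kronN (fun k => if k == j then s else 1%:M).

Definition adj (m n : nat) (A : 'M[C]_(m, n)) : 'M[C]_(n, m) := map_mx Num.conj A^T.

Definition density_matrix (n : nat) (rho : 'M[C]_n) : Prop :=
  adj rho = rho /\ \tr rho = 1 /\
  forall v : 'cV[C]_n, 0 <= ((adj v) *m rho *m v) 0 0.

(* U_j(theta) = exp(-i theta sigma_y / 2) = cos(theta/2) I - i sin(theta/2) sigma_y *)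
Definition Uloc (t : R) : 'M[C]_2 :=
  (cos (t / 2))%:C%:M - ('i * (sin (t / 2))%:C) *: sy.

Definition Ufb (N : nat) (th : 'I_N -> R) : 'M[C]_(2 ^ N) :=
  kronN (fun j => Uloc (th j)).

Definition HS (N : nat) (eps : 'I_N -> R) (D : 'I_N -> 'I_N -> R) : 'M[C]_(2 ^ N) :=
  (1 / 2) *: 1%:M
  + \sum_(j < N) ((eps j / 2)%:C *: onsite j sz)
  + \sum_(j < N) \sum_(k < N | (j < k)%N) ((D j k)%:C *: (onsite j sz *m onsite k sz)).

(* post-feedback energy Tr(rho_F H_S) (real part; it is real for Hermitian rho) *)
Definition EF (N : nat) (eps : 'I_N -> R) (D : 'I_N -> 'I_N -> R)
  (rho : 'M[C]_(2 ^ N)) (th : 'I_N -> R) : R :=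
  complex.Re (\tr ((Ufb th *m rho *m adj (Ufb th)) *m HS eps D)).

Definition sz_rot (N : nat) (k : 'I_N) (t : R) : 'M[C]_(2 ^ N) :=
  (cos t)%:C *: onsite k sz - (sin t)%:C *: onsite k sx.

Definition Acoef (N : nat) (eps : 'I_N -> R) (D : 'I_N -> 'I_N -> R)
  (rho : 'M[C]_(2 ^ N)) (j : 'I_N) (th : 'I_N -> R) : R :=
  complex.Re ((eps j / 2)%:C * \tr (rho *m onsite j sz)
      + \sum_(k < N | k != j) (D j k)%:C * \tr (rho *m onsite j sz *m sz_rot k (th k))).

Definition Bcoef (N : nat) (eps : 'I_N -> R) (D : 'I_N -> 'I_N -> R)
  (rho : 'M[C]_(2 ^ N)) (j : 'I_N) (th : 'I_N -> R) : R :=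
  complex.Re ((eps j / 2)%:C * \tr (rho *m onsite j sx)
      + \sum_(k < N | k != j) (D j k)%:C * \tr (rho *m onsite j sx *m sz_rot k (th k))).

(* two-argument arctangent, values in (-pi, pi], atan2 0 0 = 0 *)
Definition atan2 (y x : R) : R :=
  if 0 < x then atan (y / x)
  else if x < 0 then (if 0 <= y then atan (y / x) + pi else atan (y / x) - pi)
  else if 0 < y then pi / 2 else if y < 0 then - (pi / 2) else 0.

End Defs.

(* Main.v *)
(** Conjugation by U(theta) rotates every sigma_z^k separately into
    sigma_z^k cos(theta_k) - sigma_x^k sin(theta_k), so as a function of theta_j
    alone the energy is K + A_j cos(theta_j) - B_j sin(theta_j), where K, A_j and
    B_j only involve the other angles. At a minimiser this trigonometric
    polynomial is stationary, A_j sin(theta_j) + B_j cos(theta_j) = 0; the angle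
    atan2(-B_j, A_j) solves the same linear equation, so the two angles differ by
    a zero of the sine. *)
Require Import Defs.
From HB Require Import structures.
From mathcomp Require Import all_boot all_order all_algebra.
From mathcomp Require Import all_classical all_reals all_analysis.
From mathcomp.real_closed Require Import complex.
From mathcomp Require Import ring lra.
Set Implicit Arguments. Unset Strict Implicit. Unset Printing Implicit Defensive.
Import Order.TTheory GRing.Theory Num.Theory.
Local Open Scope ring_scope.

(** * Binary digits of basis indices *)

(** Digit 0 is the parity of [i], and the remaining digits are those of [i %/ 2], so induction on
    the number of digits applies. *)
Lemma odd_divn_exp2_inj (N i i' : nat) : (i < 2 ^ N)%N -> (i' < 2 ^ N)%N ->
  (forall j, (j < N)%N -> odd (i %/ 2 ^ j) = odd (i' %/ 2 ^ j)) -> i = i'.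
Proof.
elim: N i i' => [|N IH] i i'; first by rewrite expn0 !ltnS !leqn0 => /eqP -> /eqP ->.
move=> lti lti' eq_bit.
have eq_half : (i %/ 2 = i' %/ 2)%N.
  apply: IH; rewrite ?ltn_divLR // -?expnSr // => j ltj.
  by rewrite -!divnMA -expnS; apply: eq_bit.
have := eq_bit 0%N isT; rewrite expn0 !divn1 => eq_odd.
by rewrite (divn_eq i 2) (divn_eq i' 2) eq_half !modn2 eq_odd.
Qed.

Lemma qbit_inj (N : nat) (i i' : 'I_(2 ^ N)) :
  (forall j : 'I_N, qbit j i = qbit j i') -> i = i'.
Proof.
move=> eq_bit; apply: val_inj; apply: (@odd_divn_exp2_inj N);
  rewrite ?ltn_ord // => j ltj.
have /(congr1 (@nat_of_ord _)) := eq_bit (Ordinal ltj).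
by rewrite !inordK ?ltnS ?leq_b1 //=; case: (odd _); case: (odd _).
Qed.

(** Reading off digits is a bijection from indices to bit strings, so this is distributivity of
    products over sums. It lets products of Kronecker matrices be computed factor by factor. *)
Lemma sum_prod_qbit (K : comPzSemiRingType) (N : nat) (F : 'I_N -> 'I_2 -> K) :
  \sum_(i < 2 ^ N) \prod_(j < N) F j (qbit j i) = \prod_(j < N) \sum_b F j b.
Proof.
rewrite bigA_distr_bigA /=.
have bij : bijective (fun i : 'I_(2 ^ N) => [ffun j : 'I_N => qbit j i]).
  apply: inj_card_bij; last by rewrite card_ffun !card_ord.
  by move=> i i' /ffunP eq_f; apply: qbit_inj => j; have := eq_f j; rewrite !ffunE.
rewrite (reindex _ (onW_bij _ bij)) /=.
by apply: eq_bigr => i _; apply: eq_bigr => j _; rewrite ffunE.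
Qed.

(** * Matrix and trace identities *)

Lemma scaleB_mxE (K : pzRingType) (m n : nat) (x y : K) (A B : 'M[K]_(m, n)) i j :
  (x *: A - y *: B) i j = x * A i j - y * B i j.
Proof. by rewrite !mxE. Qed.

Lemma mulmx_conjM (K : pzSemiRingType) (n : nat) (U V A B : 'M[K]_n) : U *m V = 1%:M ->
  V *m (A *m B) *m U = (V *m A *m U) *m (V *m B *m U).
Proof.
move=> UV; rewrite !mulmxA; congr (_ *m _ *m _).
by rewrite -!mulmxA UV mulmx1.
Qed.

Lemma mulmx_swap (K : pzSemiRingType) (n : nat) (X A B : 'M[K]_n) :
  A *m B = B *m A -> X *m A *m B = X *m B *m A.
Proof. by move=> AB; rewrite -mulmxA AB mulmxA. Qed.

Lemma mxtrace_mul_scaleB (K : comPzRingType) (n : nat) (x y : K) (X Y A B : 'M[K]_n) :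
  \tr (X *m (x *: A - y *: B) *m Y) = x * \tr (X *m A *m Y) - y * \tr (X *m B *m Y).
Proof.
by rewrite mulmxBr mulmxBl linearB /= -!scalemxAr -!scalemxAl !mxtraceZ.
Qed.

Lemma mxtrace_mul_scaleBr (K : comPzRingType) (n : nat) (x y : K) (X A B : 'M[K]_n) :
  \tr (X *m (x *: A - y *: B)) = x * \tr (X *m A) - y * \tr (X *m B).
Proof. by rewrite mulmxBr linearB /= -!scalemxAr !mxtraceZ. Qed.

(** Final bookkeeping of the energy expansion: [h] is the constant term, [e * u] the field term of
    the chosen site, [v] the other fields, [w] the pairs containing the site and [x] the remaining
    pairs. *)
Lemma collect_cos_sin (K : comPzRingType) (h e u v w x c s a a' b b' : K) :
  u = c * a - s * b -> w = c * a' - s * b' ->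
  h + (e * u + v) + (w + x) = h + v + x + (c * (e * a + a') - s * (e * b + b')).
Proof. by move=> -> ->; ring. Qed.

(** * Kronecker products and one-site operators *)

Section Kron.
Context {R : realType} {N : nat}.
Implicit Types (M : 'I_N -> 'M[R[i]]_2) (s : 'M[R[i]]_2) (j k : 'I_N).

Lemma eq_kronN M M' : M =1 M' -> kronN M = kronN M'.
Proof.
move=> eqM; apply/matrixP => i i'; rewrite !mxE.
by apply: eq_bigr => j _; rewrite eqM.
Qed.

Lemma kronN_mul M M' : kronN M *m kronN M' = kronN (fun j => M j *m M' j).
Proof.
apply/matrixP => i i'; rewrite !mxE.
under eq_bigr do rewrite !mxE -big_split /=.
rewrite (sum_prod_qbit (fun j b => M j (qbit j i) b * M' j b (qbit j i'))).
by apply: eq_bigr => j _; rewrite mxE.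
Qed.

Lemma kronN1 : kronN (fun=> 1%:M) = 1%:M :> 'M[R[i]]_(2 ^ N).
Proof.
apply/matrixP => i i'; rewrite !mxE; have [<-|ne_ii'] := eqVneq i i'.
  by rewrite big1 // => j _; rewrite mxE eqxx.
have [j ne_bit] : exists j : 'I_N, qbit j i != qbit j i'.
  apply/existsP; rewrite -negb_forall; apply: contraNN ne_ii' => /forallP eq_bit.
  by apply/eqP/qbit_inj => j; apply/eqP.
by rewrite (bigD1 j) //= mxE (negbTE ne_bit) mul0r.
Qed.

Lemma adj_kronN M : adj (kronN M) = kronN (fun j => adj (M j)).
Proof.
apply/matrixP => i i'; rewrite !mxE rmorph_prod.
by apply: eq_bigr => j _; rewrite !mxE.
Qed.

(** Isolating factor [j] makes the linearity in [s] visible. *)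
Lemma onsiteE j s i i' : onsite j s i i' =
  s (qbit j i) (qbit j i') *
  \prod_(k < N | k != j) (1%:M : 'M[R[i]]_2) (qbit k i) (qbit k i').
Proof.
rewrite mxE (bigD1 j) //= eqxx; congr (_ * _).
by apply: eq_bigr => k /negbTE ->.
Qed.

Lemma onsite_scaleB j (x y : R[i]) s s' :
  onsite j (x *: s - y *: s') = x *: onsite j s - y *: onsite j s'.
Proof.
by apply/matrixP => i i'; rewrite scaleB_mxE !onsiteE scaleB_mxE mulrBl !mulrA.
Qed.

Lemma onsite_comm j k s s' : j != k ->
  onsite j s *m onsite k s' = onsite k s' *m onsite j s.
Proof.
move=> ne_jk; rewrite !kronN_mul; apply: eq_kronN => l.
have [->|_] := eqVneq l j; first by rewrite (negbTE ne_jk) mul1mx mulmx1.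
by rewrite mul1mx mulmx1.
Qed.

End Kron.

(** * The rotation of a single qubit *)

Section LocalRotation.
Context {R : realType}.
Local Open Scope complex_scope.

(** The product of the two imaginary units is real, so the rotation is a real matrix and its adjoint
    is its transpose. *)
Lemma UlocE (t : R) a b : Uloc t a b =
  (if a == b then cos (t / 2) else if a == 0 then - sin (t / 2) else sin (t / 2))%:C.
Proof.
rewrite !mxE; case: (a == b); first by rewrite mulr1n mulr0 subr0.
rewrite mulr0n sub0r; case: (a == 0).
  by rewrite mulrN opprK mulrAC -expr2 sqr_i mulN1r rmorphN.
by rewrite mulrAC -expr2 sqr_i mulN1r opprK.
Qed.

Lemma adj_UlocE (t : R) a b : adj (Uloc t) a b = Uloc t b a.
Proof.
by rewrite 2!mxE UlocE; exact: conjc_real.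
Qed.

Lemma ord2_cases (a : 'I_2) : a = 0 \/ a = 1.
Proof. by case: a => [[|[|//]] ?]; [left | right]; apply: val_inj. Qed.

Lemma mulmx2E (A B : 'M[R[i]]_2) a b : (A *m B) a b = A a 0 * B 0 b + A a 1 * B 1 b.
Proof.
rewrite mxE 2!big_ord_recl big_ord0 addr0; congr (_ * _ + _ * _);
  by congr (_ _ _); exact: val_inj.
Qed.

Lemma adj_Uloc_mul (t : R) : adj (Uloc t) *m Uloc t = 1%:M.
Proof.
apply/matrixP => a b; rewrite mulmx2E [RHS]mxE !adj_UlocE !UlocE.
rewrite -!rmorphM -!rmorphD /=.
have := cos2Dsin2 (t / 2).
case: (ord2_cases a) => ->; case: (ord2_cases b) => -> H /=;
  rewrite -?[RHS]/0%:C -?[RHS]/1%:C; congr _%:C; lra.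
Qed.

Lemma Uloc_rotate_sz (t : R) :
  adj (Uloc t) *m sz R *m Uloc t = (cos t)%:C *: sz R - (sin t)%:C *: sx R.
Proof.
(* The rotation has entries in [t / 2]; the double-angle formulas bring both sides to the same
   variables. *)
have [c2 s2] : cos t = cos (t / 2) ^+ 2 - sin (t / 2) ^+ 2 /\
    sin t = cos (t / 2) * sin (t / 2) *+ 2.
  have {1 4}-> : t = t / 2 + t / 2 by field.
  by rewrite cosD sinD; split; ring.
have szE a b : sz R a b = if a == b then if a == 0 then 1 else -1 else 0 by rewrite mxE.
have sxE a b : sx R a b = if a == b then 0 else 1 by rewrite mxE.
apply/matrixP => a b; rewrite !mulmx2E [RHS]scaleB_mxE.
rewrite !adj_UlocE !UlocE !szE !sxE c2 s2.
case: (ord2_cases a) => ->; case: (ord2_cases b) => -> /=;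
  rewrite !(rmorphB, rmorphD, rmorphN, rmorphM, rmorphXn, rmorphMn) /=;
  ring.
Qed.

End LocalRotation.

(** * The energy as a function of one angle *)

Section Energy.
Context {R : realType} {N : nat}.
Implicit Types (th : 'I_N -> R) (eps : 'I_N -> R) (D : 'I_N -> 'I_N -> R).
Local Open Scope complex_scope.

Lemma adj_Ufb_mul th : adj (Ufb th) *m Ufb th = 1%:M.
Proof.
by rewrite adj_kronN kronN_mul -kronN1; apply: eq_kronN => j; rewrite adj_Uloc_mul.
Qed.

Lemma Ufb_conj_onsite th j s : adj (Ufb th) *m onsite j s *m Ufb th =
  onsite j (adj (Uloc (th j)) *m s *m Uloc (th j)).
Proof.
rewrite adj_kronN !kronN_mul; apply: eq_kronN => k.
by have [->|_] := eqVneq k j; rewrite ?mulmx1 ?adj_Uloc_mul.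
Qed.

Lemma sz_rotE (j : 'I_N) (t : R) :
  sz_rot j t = onsite j ((cos t)%:C *: sz R - (sin t)%:C *: sx R).
Proof. by rewrite onsite_scaleB. Qed.

Lemma Ufb_conj_sz th j : adj (Ufb th) *m onsite j (sz R) *m Ufb th = sz_rot j (th j).
Proof. by rewrite Ufb_conj_onsite Uloc_rotate_sz sz_rotE. Qed.

Lemma sz_rot_comm (j k : 'I_N) (t u : R) : j != k ->
  sz_rot j t *m sz_rot k u = sz_rot k u *m sz_rot j t.
Proof.
by move=> ne_jk; rewrite (sz_rotE j) (sz_rotE k); exact: onsite_comm.
Qed.

Lemma Ufb_conj_HS eps D th : adj (Ufb th) *m HS eps D *m Ufb th =
  (1 / 2) *: 1%:M + \sum_(j < N) ((eps j / 2)%:C *: sz_rot j (th j))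
  + \sum_(j < N) \sum_(k < N | (j < k)%N)
      ((D j k)%:C *: (sz_rot j (th j) *m sz_rot k (th k))).
Proof.
(* Unitarity in the other order allows [U] and its adjoint to be inserted between the two factors of
   each coupling term. *)
have UU := mulmx1C (adj_Ufb_mul th).
rewrite /HS !mulmxDr !mulmxDl; congr (_ + _ + _).
- by rewrite -scalemxAr -scalemxAl mulmx1 adj_Ufb_mul.
- rewrite mulmx_sumr mulmx_suml; apply: eq_bigr => j _.
  by rewrite -scalemxAr -scalemxAl Ufb_conj_sz.
- rewrite mulmx_sumr mulmx_suml; apply: eq_bigr => j _.
  rewrite mulmx_sumr mulmx_suml; apply: eq_bigr => k _.
  by rewrite -scalemxAr -scalemxAl (mulmx_conjM _ _ UU)
    (Ufb_conj_sz th j) (Ufb_conj_sz th k).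
Qed.

(** A pair containing [j] has it either as larger or as smaller index; symmetry turns the first kind
    into [F j a], and the two kinds together run over all [k != j]. *)
Lemma sum_ltn_pairs_at (V : nmodType) (F : 'I_N -> 'I_N -> V) (j : 'I_N) :
  (forall k, k != j -> F k j = F j k) ->
  \sum_(a < N) \sum_(b < N | (a < b)%N) F a b =
  \sum_(k < N | k != j) F j k
  + \sum_(a < N | a != j) \sum_(b < N | (a < b)%N && (b != j)) F a b.
Proof.
move=> symF; rewrite (bigD1 j) //=.
have -> : \sum_(a < N | a != j) \sum_(b < N | (a < b)%N) F a b =
    \sum_(a < N | (a < j)%N) F j a
    + \sum_(a < N | a != j) \sum_(b < N | (a < b)%N && (b != j)) F a b.
  rewrite (bigID (fun a : 'I_N => (a < j)%N)) /=.
  rewrite [X in _ = _ + X](bigID (fun a : 'I_N => (a < j)%N)) /= addrA; congr (_ + _).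
    rewrite [X in _ = X + _](eq_bigl (fun a : 'I_N => (a != j) && (a < j)%N)) => [|a].
      rewrite -big_split /=; apply: eq_bigr => a /andP[ne_aj lt_aj].
      by rewrite (bigD1 j) //= symF.
    by rewrite -val_eqE /= ltn_neqAle andbA andbb.
  (* Here [a] lies above [j], so [a < b] already excludes [b = j]. *)
  apply: eq_bigr => a /andP[_ ge_aj]; apply: eq_bigl => b.
  case: eqP => [->|_]; last by rewrite andbT.
  by rewrite andbF (negbTE ge_aj).
rewrite addrA; congr (_ + _).
rewrite [RHS](bigID (fun k : 'I_N => (j < k)%N)) /=; congr (_ + _); apply: eq_bigl => k.
  by rewrite -val_eqE /= neq_ltn; case: ltngtP.
by rewrite -val_eqE /= neq_ltn; case: ltngtP.
Qed.

Lemma ReD (x y : R[i]) : complex.Re (x + y) = complex.Re x + complex.Re y.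
Proof. by case: x; case: y. Qed.

Lemma Re_scaleB (x y : R) (z w : R[i]) :
  complex.Re (x%:C * z - y%:C * w) = x * complex.Re z - y * complex.Re w.
Proof. by case: z w => a b [c d] /=; rewrite !mul0r !subr0. Qed.

Lemma tr_mul_sz_rot (X Y : 'M[R[i]]_(2 ^ N)) (j : 'I_N) (t : R) :
  \tr (X *m sz_rot j t *m Y) = (cos t)%:C * \tr (X *m onsite j (sz R) *m Y)
    - (sin t)%:C * \tr (X *m onsite j (sx R) *m Y).
Proof. exact: mxtrace_mul_scaleB. Qed.

(** The constant [K] of the expansion, kept complex so that the splitting is proved before real
    parts are taken. *)
Definition EF_rest eps D (rho : 'M[R[i]]_(2 ^ N)) (j : 'I_N) th : R[i] :=
  (1 / 2) * \tr rho
  + \sum_(k < N | k != j) (eps k / 2)%:C * \tr (rho *m sz_rot k (th k))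
  + \sum_(a < N | a != j) \sum_(b < N | (a < b)%N && (b != j))
      (D a b)%:C * \tr (rho *m sz_rot a (th a) *m sz_rot b (th b)).

Lemma EF_split eps D (rho : 'M[R[i]]_(2 ^ N)) (j : 'I_N) th :
  (forall a b, D a b = D b a) ->
  EF eps D rho th = complex.Re (EF_rest eps D rho j th)
    + (cos (th j) * Acoef eps D rho j th - sin (th j) * Bcoef eps D rho j th).
Proof.
move=> symD; rewrite /EF -Re_scaleB -ReD.
congr complex.Re.
(* Cyclicity of the trace moves the rotation from the state to the Hamiltonian. *)
have -> : \tr (Ufb th *m rho *m adj (Ufb th) *m HS eps D) =
    \tr (rho *m (adj (Ufb th) *m HS eps D *m Ufb th)).
  by rewrite -!mulmxA mxtrace_mulC !mulmxA.
rewrite Ufb_conj_HS !mulmxDr !linearD /= -scalemxAr mulmx1 linearZ /= /EF_rest.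
rewrite !mulmx_sumr !linear_sum /= (bigD1 j) //=.
have trS k : \tr (rho *m ((eps k / 2)%:C *: sz_rot k (th k))) =
    (eps k / 2)%:C * \tr (rho *m sz_rot k (th k)).
  by rewrite -scalemxAr linearZ.
under eq_bigr do rewrite trS.
rewrite trS.
have -> : \sum_(a < N) \tr (rho *m \sum_(b < N | (a < b)%N)
      ((D a b)%:C *: (sz_rot a (th a) *m sz_rot b (th b)))) =
    \sum_(a < N) \sum_(b < N | (a < b)%N)
      (D a b)%:C * \tr (rho *m sz_rot a (th a) *m sz_rot b (th b)).
  apply: eq_bigr => a _; rewrite mulmx_sumr linear_sum; apply: eq_bigr => b _.
  by rewrite -scalemxAr linearZ /= mulmxA.
(* Symmetry of the summand combines that of [D] with commutation of rotated operators on distinct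
   sites. *)
rewrite (@sum_ltn_pairs_at _ _ j) => [|k ne_kj]; last first.
  exact: (congr2 (fun d X => d%:C * \tr X) (symD _ _)
    (mulmx_swap rho (sz_rot_comm _ _ ne_kj))).
apply: collect_cos_sin; first exact: mxtrace_mul_scaleBr.
rewrite 2!mulr_sumr -sumrB; apply: eq_bigr => k _.
by rewrite tr_mul_sz_rot mulrBr; congr (_ - _); exact: mulrCA.
Qed.

Lemma eq_EF_rest eps D rho j th th' : (forall k, k != j -> th k = th' k) ->
  EF_rest eps D rho j th = EF_rest eps D rho j th'.
Proof.
move=> eq_th.
refine (congr2 (fun x y : R[i] => 1 / 2 * \tr rho + x + y)
  (eq_bigr _ (fun k ne_kj => _)) (eq_bigr _ (fun a ne_aj => _))).
  by rewrite (eq_th k ne_kj).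
apply: eq_bigr => b /andP[_ ne_bj].
by rewrite (eq_th a ne_aj) (eq_th b ne_bj).
Qed.

Lemma eq_Acoef eps D rho j th th' : (forall k, k != j -> th k = th' k) ->
  Acoef eps D rho j th = Acoef eps D rho j th'.
Proof.
move=> eq_th; refine (congr1 (fun z : R[i] =>
  complex.Re ((eps j / 2)%:C * \tr (rho *m onsite j (sz R)) + z))
  (eq_bigr _ (fun k ne_kj => _))).
by rewrite (eq_th k ne_kj).
Qed.

Lemma eq_Bcoef eps D rho j th th' : (forall k, k != j -> th k = th' k) ->
  Bcoef eps D rho j th = Bcoef eps D rho j th'.
Proof.
move=> eq_th; refine (congr1 (fun z : R[i] =>
  complex.Re ((eps j / 2)%:C * \tr (rho *m onsite j (sx R)) + z))
  (eq_bigr _ (fun k ne_kj => _))).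
by rewrite (eq_th k ne_kj).
Qed.

End Energy.

(** * Trigonometric polynomials and the two-argument arctangent *)

Section Trigonometry.
Context {R : realType}.
Implicit Types a b p q t x : R.

(** Subtracting the floor multiple of [pi] leaves a remainder in [[0, pi)] whose sine still
    vanishes; sine is positive on the open interval, so the remainder is 0. *)
Lemma sin_eq0_int x : sin x = 0 -> exists m : int, x = m%:~R * pi.
Proof.
move=> sx0; have pi0 := @pi_gt0 R.
exists (Num.floor (x / pi)); set m := Num.floor _.
have /andP[le_m lt_m] : m%:~R <= x / pi < (m + 1)%:~R.
  by rewrite floor_le_tmp floorD1_gt.
move: le_m lt_m; rewrite ler_pdivlMr // ltr_pdivrMr // => le_m lt_m.
have sin_int (n : nat) : sin (n%:R * pi) = 0 :> R.
  elim: n => [|n IH]; first by rewrite mul0r sin0.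
  by rewrite -natr1 mulrDl mul1r sinDpi IH oppr0.
have sm0 : sin (m%:~R * pi : R) = 0.
  by case: (m) => n; rewrite ?NegzE ?rmorphN /= -?pmulrn ?mulNr ?sinN sin_int ?oppr0.
apply/eqP; rewrite eq_sym -subr_eq0 -oppr_eq0 opprB; apply/eqP.
have : sin (x - m%:~R * pi) = 0 by rewrite sinB sx0 sm0 mul0r mulr0 subr0.
apply: contra_eq => ne0; apply: lt0r_neq0; apply: sin_gt0_pi.
rewrite lt_neqAle eq_sym ne0 subr_ge0 le_m /= ltrBlDr.
by move: lt_m; rewrite rmorphD mulrDl mul1r addrC.
Qed.

Lemma sin_cos_atan2 a b : (a, b) != (0, 0) ->
  a * sin (atan2 (- b) a) + b * cos (atan2 (- b) a) = 0.
Proof.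
move=> ab0.
have aux : a != 0 -> a * sin (atan (- b / a)) + b * cos (atan (- b / a)) = 0.
  move=> a0; have cneq : cos (atan (- b / a)) != 0.
    by rewrite cos_atan invr_neq0 // sqrtr_eq0 -ltNge ltr_pwDl // sqr_ge0.
  have := atanK (- b / a); rewrite /tan => tanE.
  rewrite -[sin _](divfK cneq) tanE; field.
  exact: a0.
rewrite /atan2; case: (ltgtP 0 a) => /= [a_gt0|a_lt0|a0].
- exact: aux (lt0r_neq0 a_gt0).
(* A shift by [pi] in either direction negates both sine and cosine. *)
- have := aux (ltr0_neq0 a_lt0).
  case: ifP => _ E; [rewrite cosD sinD | rewrite cosB sinB];
    by rewrite cospi sinpi; lra.
(* With [a = 0] the angle is plus or minus [pi / 2], where the cosine vanishes. *)
- move: ab0; rewrite -a0 xpair_eqE eqxx /= => b0; rewrite mul0r add0r.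
  rewrite oppr_gt0 oppr_lt0.
  by case: (ltgtP b 0) b0 => // _ _; rewrite ?cosN cos_pihalf mulr0.
Qed.

Lemma atan2_mod_pi a b t : (a, b) != (0, 0) -> a * sin t + b * cos t = 0 ->
  exists m : int, t = atan2 (- b) a + m%:~R * pi.
Proof.
move=> ab0 t0; have u0 := sin_cos_atan2 ab0.
set u := atan2 _ _ in u0 *.
have [m tu] : exists m : int, t - u = m%:~R * pi.
  apply: sin_eq0_int; rewrite sinB.
  (* Eliminating between the two linear equations shows that [a] and [b] both annihilate
     [sin (t - u)]; one of them is nonzero. *)
  have aS : a * (sin t * cos u - cos t * sin u) = 0.
    have -> : a * (sin t * cos u - cos t * sin u) =
      (a * sin t + b * cos t) * cos u - (a * sin u + b * cos u) * cos t by ring.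
    by rewrite t0 u0 !mul0r subr0.
  have bS : b * (sin t * cos u - cos t * sin u) = 0.
    have -> : b * (sin t * cos u - cos t * sin u) =
      (a * sin u + b * cos u) * sin t - (a * sin t + b * cos t) * sin u by ring.
    by rewrite t0 u0 !mul0r subr0.
  move: ab0; rewrite xpair_eqE; apply: contraNeq => S0.
  by move/eqP: aS; move/eqP: bS; rewrite !mulf_eq0 (negbTE S0) !orbF => -> ->.
by exists m; rewrite -tu addrC subrK.
Qed.

(* The point opposite to (p, q) on its circle is reached at some angle, and
   there the trigonometric polynomial takes the value -sqrt(p^2 + q^2). *)
Lemma cos_sin_min0 p q : (forall t, p <= p * cos t - q * sin t) -> q = 0.
Proof.
move=> pmin; apply: contraTeq isT => q0.
pose r := Num.sqrt (p ^+ 2 + q ^+ 2).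
have q2 : 0 < q ^+ 2 by rewrite exprn_even_gt0.
have r2 : r ^+ 2 = p ^+ 2 + q ^+ 2 by rewrite sqr_sqrtr // addr_ge0 // sqr_ge0.
have r0 : 0 < r by rewrite sqrtr_gt0 ltr_wpDl // sqr_ge0.
have pr : -1 <= - p / r <= 1.
  rewrite -ler_norml -(@ler_pXn2r _ 2) ?nnegrE // expr1n real_normK ?num_real //.
  by rewrite expr_div_n sqrrN r2 ler_pdivrMr ?mul1r ?lerDl ?ltW // ltr_wpDl ?sqr_ge0.
have sE : sin (acos (- p / r)) = `|q| / r.
  rewrite sin_acos //; have -> : 1 - (- p / r) ^+ 2 = (q / r) ^+ 2.
    by rewrite !expr_div_n r2 sqrrN; field; rewrite -r2 sqrf_eq0 gt_eqF.
  by rewrite sqrtr_sqr normrM normfV (gtr0_norm r0).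
(* The factor [Num.sg q] leaves the cosine unchanged and gives the sine the sign of [q]. *)
have := pmin (Num.sg q * acos (- p / r)).
rewrite cos_sg // sin_sg sE acosK ?in_itv //=.
have -> : p * (- p / r) - q * (Num.sg q * (`|q| / r)) = - r.
  have -> : q * (Num.sg q * (`|q| / r)) = q * q / r.
    by rewrite !mulrA -[q * _ * _]mulrA -numEsg.
  have rne0 := lt0r_neq0 r0.
  by transitivity (- (p ^+ 2 + q ^+ 2) / r); [field | rewrite -r2; field].
(* Now [p <= - r] with [r > 0] forces [r ^+ 2 <= p ^+ 2], against [q ^+ 2 > 0]. *)
move=> le_pr; nra.
Qed.

(** No derivative is taken: shifting the angle by [u] moves the minimum to 0, and the sine
    coefficient of the shifted polynomial is, up to sign, the quantity to be killed. *)
Lemma trig_min_stationary a b u :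
  (forall t, cos u * a - sin u * b <= cos t * a - sin t * b) ->
  a * sin u + b * cos u = 0.
Proof.
move=> umin; apply: (@cos_sin_min0 (cos u * a - sin u * b)) => t.
apply: le_trans (umin (u + t)) _; rewrite cosD sinD.
by rewrite le_eqVlt; apply/orP; left; apply/eqP; ring.
Qed.

End Trigonometry.

(** The tangent equation is stated with denominators cleared, which covers [a = 0]. When both
    coefficients vanish the energy is constant in [th j], so the [atan2] form assumes a nonzero
    pair. *)
Theorem theorem1 (R : realType) (N : nat) (HN : (0 < N)%N)
  (eps : 'I_N -> R) (D : 'I_N -> 'I_N -> R)
  (HD : forall j k, D j k = D k j)
  (rho : 'M[R[i]]_(2 ^ N)) (Hrho : density_matrix rho)
  (th : 'I_N -> R)
  (Hmin : forall th' : 'I_N -> R, EF eps D rho th <= EF eps D rho th') :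
  forall j : 'I_N,
    let a := Acoef eps D rho j th in
    let b := Bcoef eps D rho j th in
    a * sin (th j) + b * cos (th j) = 0 /\
    ((a, b) != (0, 0) -> exists m : int, th j = atan2 (- b) a + m%:~R * pi).
Proof.
move=> j a b.
have stat : a * sin (th j) + b * cos (th j) = 0.
  apply: trig_min_stationary => t.
  (* Only angle [j] is varied, so the rest and both coefficients agree at [th] and [th']. *)
  pose th' k := if k == j then t else th k.
  have eq_th k : k != j -> th k = th' k by rewrite /th' => /negbTE ->.
  have := Hmin th'; rewrite !(@EF_split _ _ _ _ _ j) //.
  rewrite -(eq_EF_rest eps D rho eq_th) lerD2l.
  by rewrite -(eq_Acoef eps D rho eq_th) -(eq_Bcoef eps D rho eq_th) /th' eqxx.
by split=> // ab0; apply: atan2_mod_pi.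
Qed.
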